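(* Let $G=(V,E)$ be a finite, simple, connected graph with $|E|\geq 2$. Then the graph automaton group $\mathcal{G}_G$ has exponential growth.
   Context: Graph automaton group: given a finite simple graph $G=(V,E)$, choose an orientation of every edge and let $E'$ be the resulting set of ordered pairs. Let $V^*$ be the set of finite words over the alphabet $V$. Each oriented edge $e=(x,y)\in E'$ acts as a length-preserving bijection of $V^*$ defined recursively by $e(\emptyset)=\emptyset$, $e(xw)=y\,e(w)$, $e(yw)=xw$, and $e(zw)=zw$ for $z\in V\setminus\{x,y\}$, $w\in V^*$. The group $\mathcal{G}_G$ is the group of bijections of $V^*$ generated by the elements of $E'$ (it does not depend on the orientation). Growth: for a group $\mathcal{G}$ with finite symmetric generating set $S=S^{-1}$, let $\gamma_S(n)$ be the number of elements of $\mathcal{G}$ of word length at most $n$ with respect to $S$. $\mathcal{G}$ has exponential growth if $\lim_{n\to\infty}\sqrt[n]{\gamma_S(n)}>1$ (this property is independent of $S$). *)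

(* Defs.v *)
From HB Require Import structures.
From mathcomp Require Import all_boot all_order all_algebra finmap.
From mathcomp Require Import boolp classical_sets cardinality reals.
From mathcomp Require Import topology normedtype sequences exp.

Set Implicit Arguments.
Unset Strict Implicit.
Unset Printing Implicit Defensive.

Import numFieldNormedType.Exports.

Local Open Scope group_scope.

Section Symmetric.
Variable T : choiceType.

Record bijection := Bijection {
  bijection_fun :> T -> T;
  bijection_asbool : `[< bijective bijection_fun >] }.

HB.instance Definition _ := [isSub for bijection_fun].
HB.instance Definition _ := [Choice of bijection by <:].

Implicit Types f g h : bijection.

Lemma bijectionP f : bijective f.
Proof. exact/asboolP/(bijection_asbool f). Qed.

Lemma eq_bijection f g : f =1 g -> f = g.
Proof. by move=> fg; apply/val_inj/funext. Qed.

Definition bijection_one : bijection :=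
  Bijection (asboolT (@Bijective T T idfun idfun (frefl _) (frefl _))).

(* Left action convention: (f * g) w = f (g w). *)
Definition bijection_mul f g : bijection :=
  Bijection (asboolT (bij_comp (bijectionP f) (bijectionP g))).

Lemma bijection_invP f : {f' : T -> T | cancel f f' /\ cancel f' f}.
Proof. by apply: cid; case: (bijectionP f) => f' fK f'K; exists f'. Qed.

Definition bijection_inv f : bijection :=
  let: exist f' (conj fK f'K) := bijection_invP f in
  Bijection (asboolT (Bijective f'K fK)).

Lemma bijection_mulA : associative bijection_mul.
Proof. by move=> f g h; apply: eq_bijection. Qed.

Lemma bijection_mul1 : left_id bijection_one bijection_mul.
Proof. by move=> f; apply: eq_bijection. Qed.

Lemma bijection_mulr1 : right_id bijection_one bijection_mul.
Proof. by move=> f; apply: eq_bijection. Qed.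

Lemma bijection_mulV : left_inverse bijection_one bijection_inv bijection_mul.
Proof.
move=> f; apply: eq_bijection => x /=; rewrite /bijection_inv.
by case: bijection_invP => f' [fK f'K] /=; rewrite fK.
Qed.

Lemma bijection_mulrV : right_inverse bijection_one bijection_inv bijection_mul.
Proof.
move=> f; apply: eq_bijection => x /=; rewrite /bijection_inv.
by case: bijection_invP => f' [fK f'K] /=; rewrite f'K.
Qed.

HB.instance Definition _ := isGroup.Build bijection
  bijection_mulA bijection_mul1 bijection_mulr1 bijection_mulV bijection_mulrV.

End Symmetric.

Section Generated.
Variable gT : groupType.

Definition generated (A : set gT) : {pred gT} :=
  fun g => `[< forall H : {pred gT},
                 group_closed H -> (forall a, A a -> a \in H) -> g \in H >].

Lemma generated_closed (A : set gT) : group_closed (generated A).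
Proof.
split=> [|x y /asboolP xA /asboolP yA]; apply/asboolP => H Hcl AH.
  exact: Hcl.1.
by apply: Hcl.2; [exact: xA | exact: yA].
Qed.

Record generated_group (A : set gT) := GeneratedGroup {
  generated_elt :> gT;
  generated_eltP : generated_elt \in generated A }.

HB.instance Definition _ (A : set gT) := [isSub for @generated_elt A].
HB.instance Definition _ (A : set gT) := [Choice of generated_group A by <:].
HB.instance Definition _ (A : set gT) :=
  SubChoice_isSubGroup.Build gT (mem (generated A)) (generated_group A)
    (generated_closed A).

End Generated.

Section Growth.
Variable gT : groupType.
Implicit Type S : {fset gT}.

Definition symmetric_generating_set S : Prop :=
  (forall s, s \in S -> s^-1 \in S) /\
  (forall g, g \in generated [set s | s \in S]%classic).

Definition word_ball S (n : nat) : set gT :=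
  [set g | exists w : seq gT,
     [/\ (size w <= n)%N, {subset w <= S} & g = \prod_(s <- w) s]]%classic.

(* [word_ball S n] is finite since [S] is, so [fset_set] does not take its
   default value here. *)
Definition growth S (n : nat) : nat := #|` fset_set (word_ball S n)|.

Definition growth_root (R : realType) S (n : nat) : R :=
  ((growth S n)%:R `^ (n%:R^-1))%R.

(* The limit does not have a preferred generating set: finite generation is
   asked for, and the condition is imposed on every finite symmetric one. *)
Definition exponential_growth (R : realType) : Prop :=
  (exists S, symmetric_generating_set S) /\
  (forall S, symmetric_generating_set S ->
     (cvgn (growth_root R S) /\ 1 < limn (growth_root R S))%R).

End Growth.

Section GraphAutomaton.
Variable V : finType.

Fixpoint edge_act (x y : V) (w : seq V) : seq V :=
  if w is z :: w' then
    if z == x then y :: edge_act x y w'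
    else if z == y then x :: w' else w
  else [::].

Fixpoint edge_act_inv (x y : V) (w : seq V) : seq V :=
  if w is z :: w' then
    if z == y then x :: edge_act_inv x y w'
    else if z == x then y :: w' else w
  else [::].

Lemma edge_actK x y : cancel (edge_act x y) (edge_act_inv x y).
Proof.
elim=> //= z w IHw; case: (eqVneq z x) => [->|zx] /=; first by rewrite eqxx IHw.
case: (eqVneq z y) => [zy|zy] /=; last by rewrite (negbTE zy) (negbTE zx).
by rewrite -zy eq_sym (negbTE zx) eqxx.
Qed.

Lemma edge_act_invK x y : cancel (edge_act_inv x y) (edge_act x y).
Proof.
elim=> //= z w IHw; case: (eqVneq z y) => [->|zy] /=; first by rewrite eqxx IHw.
case: (eqVneq z x) => [zx|zx] /=; last by rewrite (negbTE zx) (negbTE zy).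
by rewrite -zx eq_sym (negbTE zy) eqxx.
Qed.

Definition edge_bijection (e : V * V) : bijection (seq V) :=
  Bijection (asboolT (Bijective (edge_actK e.1 e.2) (edge_act_invK e.1 e.2))).

Definition edges (E : rel V) : {set {set V}} :=
  [set [set p.1; p.2] | p : V * V & E p.1 p.2].

(* [D] contains exactly one of (x, y), (y, x) for every edge {x, y}, and
   nothing else. *)
Definition orientation (E : rel V) (D : {set V * V}) : Prop :=
  (forall x y, (x, y) \in D -> E x y) /\
  (forall x y, E x y -> ((x, y) \in D) (+) ((y, x) \in D)).

Definition graph_automaton_group (D : {set V * V}) : groupType :=
  generated_group [set edge_bijection e | e in [set` D]]%classic.

End GraphAutomaton.

(* Main.v *)
Require Import Defs.
From mathcomp Require Import all_boot all_order all_algebra finmap.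
From mathcomp Require Import boolp classical_sets cardinality reals.
From mathcomp Require Import topology normedtype sequences exp.

(* Two distinct edges at a vertex y, oriented out of y, freely generate a
   monoid.  Indeed, the section at y of a word in the two edges starts with the
   letter of the word that acts first, and it is strictly shorter than the word
   once the word has at least two letters.  If two words with different first
   letters acted in the same way, so would their sections at y, which gives an
   infinite descent.  By connectedness two edges do share a vertex.
   The growth a of a finite symmetric generating set is submultiplicative, so
   the limit exists by Fekete's lemma; for some k the free monoid gives
   2 ^ n <= a (n * k) <= a n ^ k, so the limit is at least the k-th root of 2. *)

Set Implicit Arguments.
Unset Strict Implicit.
Unset Printing Implicit Defensive.

Import Order.TTheory GRing.Theory Num.Theory.
Import numFieldNormedType.Exports.

(** * The free monoid on two edges leaving a common vertex *)

Section FreeMonoid.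
Variables (V : finType) (x y z : V).
Hypotheses (xy : x != y) (yz : y != z) (xz : x != z).

Definition letter_act (c : bool) : seq V -> seq V :=
  edge_act y (if c then x else z).

Fixpoint word_act (u : seq bool) (w : seq V) : seq V :=
  if u is c :: u' then word_act u' (letter_act c w) else w.

Fixpoint state (u : seq bool) (q : V) : V :=
  if u is c :: u' then
    let t := if c then x else z in
    state u' (if q == y then t else if q == t then y else q)
  else q.

(** An edge out of [y] has itself as section at [y] and the identity at every other letter. A
    section of a word is therefore a subword: the letters applied while the running state is [y]. *)
Fixpoint section (u : seq bool) (q : V) : seq bool :=
  if u is c :: u' then
    let t := if c then x else z in
    if q == y then c :: section u' t
    else section u' (if q == t then y else q)
  else [::].

Lemma word_act_cons u q w :
  word_act u (q :: w) = state u q :: word_act (section u q) w.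
Proof.
elim: u q w => //= c u IHu q w; rewrite /letter_act /=.
case: (eqVneq q y) => [_|_]; first by rewrite IHu.
by case: ifP => _; rewrite IHu.
Qed.

Lemma size_section u q : (size (section u q) <= size u)%N.
Proof.
by elim: u q => //= c u IHu q; case: ifP => _; [exact: IHu | exact/leqW/IHu].
Qed.

(* After emitting a letter the state is [x] or [z], and the next letter of the
   word is not emitted from there, so the section is strictly shorter. *)
Lemma size_section_neq u q : q != y -> (size (section u q) <= (size u).-1)%N.
Proof. by case: u => //= c u /negbTE ->; apply: size_section. Qed.

Lemma section_cons c u :
  exists2 v, section (c :: u) y = c :: v & (size v <= (size u).-1)%N.
Proof.
exists (section u (if c then x else z)); first by rewrite /= eqxx.
by apply: size_section_neq; case: c; rewrite // eq_sym.
Qed.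

Lemma word_act_section u v q :
  word_act u =1 word_act v -> word_act (section u q) =1 word_act (section v q).
Proof. by move=> uv w; have := uv (q :: w); rewrite !word_act_cons => -[]. Qed.

Lemma letter_act_neq c : letter_act c [:: y] != [:: y].
Proof.
by rewrite /letter_act /= eqxx eqseq_cons andbT; case: c; rewrite // eq_sym.
Qed.

(** Descent: a single letter moves [[:: y]], and a longer word acting trivially has a nonempty,
    strictly shorter section at [y] that also acts trivially. *)
Lemma word_act_eq_nil v : word_act v =1 id -> v = [::].
Proof.
have [n] := ubnP (size v); elim: n => // n IHn in v *.
case: v => // c v; rewrite /= ltnS => vn vid.
have [s sE ss] := section_cons c v.
case: v vn vid sE ss => [|d v] vn vid sE ss.
  by have /eqP := vid [:: y]; rewrite /= (negbTE (letter_act_neq c)).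
have sid : word_act (c :: s) =1 id.
  by rewrite -sE; apply: (@word_act_section _ [::]).
have sdv : (size (c :: s) <= size (d :: v))%N by [].
by have := IHn (c :: s) (leq_ltn_trans sdv vn) sid.
Qed.

Lemma word_act_inj u v : word_act u =1 word_act v -> u = v.
Proof.
have [n] := ubnP (size u + size v); elim: n => // n IHn in u v *.
case: u v => [|c u] [|d v] //; rewrite ?addn0 ltnS => uvn uv.
- by apply/esym/word_act_eq_nil => w; rewrite -uv.
- by apply/word_act_eq_nil => w; rewrite uv.
have [cd|cd] := eqVneq c d.
  rewrite -cd; congr cons; apply: IHn.
    by apply: leq_trans uvn; rewrite /= addSn ltnS leq_add2l.
  (* The common first letter acts bijectively, so it cancels. *)
  move=> w; rewrite -(edge_act_invK y (if c then x else z) w).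
  by have := uv (edge_act_inv y (if c then x else z) w); rewrite /= -cd.
have [s sE su] := section_cons c u; have [t tE tv] := section_cons d v.
(* One-letter words equal their sections at [y], so the descent stops there; their values at
   [[:: y]] differ instead. *)
have [uv0|uv0] := posnP (size u + size v).
  move: uv0 uv => /eqP; rewrite addn_eq0 !size_eq0 => /andP[/eqP-> /eqP->].
  move=> /(_ [:: y]); rewrite /= /letter_act /= eqxx => -[/eqP].
  by case: c d cd {sE tE uvn} => -[] //; rewrite 1?[z == x]eq_sym (negbTE xz).
have /IHn : (size (section (c :: u) y) + size (section (d :: v) y) < n)%N.
  rewrite sE tE; apply: leq_trans uvn => /=; rewrite !addSn !addnS !ltnS.
  case: u v su tv uv0 {uv sE tE} => [|e u] [|f v] //= su tv _.
  - by rewrite add0n ltnS; move: su; rewrite leqn0 => /eqP ->.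
  - by rewrite addn0; move: tv; rewrite leqn0 => /eqP ->; rewrite addn0.
  - by rewrite addSn ltnS; apply: leq_add => //; apply: leq_trans tv _.
move=> /(_ (word_act_section _ uv)); rewrite sE tE => -[/eqP].
by rewrite (negbTE cd).
Qed.

End FreeMonoid.

(** * Balls and growth with respect to a finite generating set *)

Section WordBall.
Local Open Scope group_scope.
Variables (gT : groupType) (S : {fset gT}).

Lemma word_ball_one : word_ball S 0 1.
Proof. by exists [::]; rewrite big_nil. Qed.

Lemma word_ball_le m n :
  (m <= n)%N -> (word_ball S m `<=` word_ball S n)%classic.
Proof. by move=> mn g [w [wm wS ->]]; exists w; rewrite (leq_trans wm). Qed.

Lemma word_ballM m n g h :
  word_ball S m g -> word_ball S n h -> word_ball S (m + n) (g * h).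
Proof.
move=> [u [um uS ->]] [v [vn vS ->]]; exists (u ++ v); split.
- by rewrite size_cat leq_add.
- by move=> s; rewrite mem_cat => /orP[/uS|/vS].
- by rewrite big_cat.
Qed.

Lemma word_ballD m n : (word_ball S (m + n) `<=`
  [set g * h | g in word_ball S m & h in word_ball S n])%classic.
Proof.
move=> _ [w [wmn wS ->]].
exists (\prod_(s <- take m w) s).
  exists (take m w); split=> // [|s /mem_take/wS //].
  by rewrite size_take_min geq_minl.
exists (\prod_(s <- drop m w) s); last by rewrite -big_cat cat_take_drop.
exists (drop m w); split=> // [|s /mem_drop/wS //].
by rewrite size_drop leq_subLR.
Qed.

Lemma finite_word_ball n : finite_set (word_ball S n).
Proof.
elim: n => [|n IHn].
  apply: (@sub_finite_set _ _ [set 1]%classic) (finite_set1 _).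
  move=> _ [w [w0 _ ->]].
  by move: w0; rewrite leqn0 size_eq0 => /eqP ->; rewrite big_nil.
have ball1 : finite_set (word_ball S 1).
  apply: (@sub_finite_set _ _ [set` (1 |` S)%fset]%classic) (finite_fset _).
  move=> _ [w [w1 wS ->]] /=.
  case: w w1 wS => [|s [|//]] _ wS; rewrite ?big_nil ?big_seq1 !inE ?eqxx //.
  by rewrite wS ?orbT ?mem_head.
rewrite -addn1; apply: sub_finite_set (@word_ballD _ _) _.
exact: finite_image2.
Qed.

Lemma mem_fset_word_ball n g :
  g \in fset_set (word_ball S n) <-> word_ball S n g.
Proof. by rewrite in_fset_set ?inE //; apply: finite_word_ball. Qed.

Lemma growth_gt0 n : (0 < growth S n)%N.
Proof.
rewrite cardfs_gt0; apply/fset0Pn; exists 1; apply/mem_fset_word_ball.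
exact: word_ball_le (leq0n n) _ word_ball_one.
Qed.

Lemma growthD m n : (growth S (m + n) <= growth S m * growth S n)%N.
Proof.
rewrite /growth -(size_allpairs *%g); apply: uniq_leq_size => // g.
move=> /mem_fset_word_ball/word_ballD[h hm [k kn <-]].
by apply/allpairsP; exists (h, k); split=> //=; apply/mem_fset_word_ball.
Qed.

(** By symmetry of [S] the union of all balls is a subgroup; it contains [S]. *)
Lemma word_ball_generated g :
  symmetric_generating_set S -> exists n, word_ball S n g.
Proof.
move=> [SV /(_ g)/asboolP] /(_ [pred g | `[< exists n, word_ball S n g >]]).
have ballV n h : word_ball S n h -> word_ball S n h^-1.
  move=> [w [wn wS ->]]; elim: w n wn wS => [|s w IHw] n wn wS.
    by rewrite big_nil invg1; apply: word_ball_le (leq0n n) _ word_ball_one.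
  case: n wn => // n wn; rewrite big_cons invgM -addn1; apply: word_ballM.
    by apply: IHw => // t tw; apply: wS; rewrite inE tw orbT.
  exists [:: s^-1]; rewrite big_seq1; split=> // t; rewrite inE => /eqP ->.
  by apply/SV/wS; rewrite mem_head.
move=> gen; apply/asboolP/gen.
  split; first by apply/asboolP; exists 0%N; apply: word_ball_one.
  move=> h k /asboolP[m hm] /asboolP[n kn]; apply/asboolP; exists (m + n)%N.
  by apply: word_ballM => //; apply: ballV.
move=> s sS; apply/asboolP; exists 1%N, [:: s]; rewrite big_seq1; split=> //.
by move=> t; rewrite inE => /eqP ->.
Qed.

Lemma growth_free_monoid (f : bool -> gT) :
  symmetric_generating_set S ->
  injective (fun u : seq bool => \prod_(c <- u) f c) ->
  exists2 k, (0 < k)%N & forall n, (2 ^ n <= growth S n ^ k)%N.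
Proof.
move=> Sgen finj; have [k1 fk1] := word_ball_generated (f true) Sgen.
have [k2 fk2] := word_ball_generated (f false) Sgen.
(* A common radius for both generators; the successor keeps it positive. *)
pose k := (k1 + k2).+1; exists k => // n.
have fk c : word_ball S k (f c).
  case: c; [apply: word_ball_le fk1 | apply: word_ball_le fk2]; apply: leqW.
    exact: leq_addr.
  exact: leq_addl.
have kn : (2 ^ n <= growth S (n * k))%N.
  rewrite -card_bool -card_tuple cardE.
  rewrite -(size_map (fun u : n.-tuple bool => \prod_(c <- u) f c)).
  apply: uniq_leq_size.
    by rewrite map_inj_uniq ?enum_uniq // => u v /finj/val_inj.
  move=> _ /mapP[u _ ->]; apply/mem_fset_word_ball; rewrite -{1}(size_tuple u).
  elim: (tval u) => [|c s IHs]; first by rewrite big_nil; apply: word_ball_one.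
  by rewrite big_cons mulSn; apply: word_ballM.
(* Submultiplicativity turns the factor [k] in the radius into an exponent, so the bound concerns
   every radius [n], not only multiples of [k]. *)
apply: leq_trans kn _; rewrite mulnC /k; elim: (k1 + k2)%N => [|j IHj].
  by rewrite mul1n expn1.
by rewrite mulSn expnS; apply: leq_trans (growthD _ _) _; apply: leq_mul.
Qed.

End WordBall.

(** * Fekete's subadditive lemma *)

Section Fekete.
Local Open Scope ring_scope.
Local Open Scope classical_set_scope.
Variable R : realType.

Lemma subadditiveM (c : nat -> R) (m n r : nat) :
  (forall i j, c (i + j)%N <= c i + c j) -> c (n * m + r)%N <= n%:R * c m + c r.
Proof.
move=> cD; elim: n => [|n IHn]; first by rewrite mul0r add0r.
rewrite mulSn -addnA; apply: le_trans (cD _ _) _.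
by rewrite -natr1 mulrDl mul1r [_ + c m]addrC -addrA lerD2l.
Qed.

Lemma fekete (c : nat -> R) : (forall n, 0 <= c n) ->
  (forall m n, c (m + n)%N <= c m + c n) -> cvgn (fun n => c n / n%:R).
Proof.
(* The limit is the infimum of [A]. Index 0 is left out because division by zero gives 0, which
   would spoil the infimum. *)
move=> c0 cD; pose A := [set c n.+1 / n.+1%:R | n in setT].
have lbA : lbound A 0 by move=> _ [n _ <-]; rewrite divr_ge0.
have infA : has_inf A by split; [exists (c 1 / 1%:R), 0%N | exists 0].
apply/cvg_ex; exists (inf A); apply/cvgrPdist_le => /= e e0.
have e20 : 0 < e / 2 by rewrite divr_gt0.
have [_ [m _ <-] mA] := inf_adherent e20 infA.
(* [M] bounds [c] on all remainders modulo [m.+1]. *)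
pose M : R := m.+1%:R * c 1%N + c 0%N.
have M0 : 0 <= M by rewrite addr_ge0 ?mulr_ge0.
near=> n.
have n0 : (0 < n)%N by near: n; exists 1%N.
have n0R : 0 < n%:R :> R by rewrite ltr0n.
have An : inf A <= c n / n%:R.
  by apply: ge_inf; [exists 0 | exists n.-1 => //; rewrite prednK].
rewrite ler0_norm ?subr_le0 // opprB lerBlDl.
have cr : c (n %% m.+1)%N <= M.
  rewrite -[(n %% _)%N]addn0 -[in leLHS](muln1 (n %% _)%N).
  apply: le_trans (subadditiveM _ _ _ cD) _; rewrite lerD2r ler_wpM2r //.
  by rewrite ler_nat ltnW // ltn_pmod.
have Mn : M / n%:R <= e / 2.
  rewrite ler_pdivrMr // mulrC -ler_pdivrMr //; near: n.
  exact: nbhs_infty_ger.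
(* Euclidean division of [n] by [m.+1]; as [c] is nonnegative, the quotient may be replaced by the
   larger [n / m.+1]. *)
have cn : c n / n%:R <= c m.+1 / m.+1%:R + M / n%:R.
  rewrite ler_pdivrMr // mulrDl divfK ?gt_eqF // {1}(divn_eq n m.+1).
  apply: le_trans (subadditiveM _ _ _ cD) _; apply: lerD => //.
  rewrite -mulrA [c _ * _]mulrC ler_wpM2r // ler_pdivlMl ?ltr0n // -natrM.
  by rewrite ler_nat mulnC leq_divM.
apply: le_trans cn _; rewrite [e in leRHS]splitr addrA lerD //; exact: ltW.
Unshelve. all: by end_near. Qed.

End Fekete.

(** * The limit of the n-th roots *)

Section Exponential.
Local Open Scope ring_scope.
Variable R : realType.

Lemma exponential_growth_root (a : nat -> nat) (k : nat) :
  (0 < k)%N -> (forall n, (0 < a n)%N) ->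
  (forall m n, (a (m + n) <= a m * a n)%N) -> (forall n, (2 ^ n <= a n ^ k)%N) ->
  let r : nat -> R := fun n => (a n)%:R `^ n%:R^-1 in cvgn r /\ 1 < limn r.
Proof.
move=> k0 a0 aM ak r; pose c n : R := ln (a n)%:R.
have a0R n : (0 : R) < (a n)%:R by rewrite ltr0n.
have rE : r = expR \o (fun n => c n / n%:R).
  by apply/funext => n; rewrite /r /powR gt_eqF // mulrC.
have cvr : cvgn r.
  have /cvg_ex[/= l cl] : cvgn (fun n => c n / n%:R).
    apply: fekete => [n|m n]; first by rewrite ln_ge0 // ler1n.
    by rewrite /c -lnM ?posrE // ler_ln ?posrE ?mulr_gt0 // -natrM ler_nat.
  apply/cvg_ex; exists (expR l); rewrite rE.
  by apply: continuous_cvg cl; apply: continuous_expR.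
split=> //; apply: (@lt_le_trans _ _ (expR (ln 2 / k%:R))).
  by rewrite expR_gt1 divr_gt0 ?ltr0n // ln_gt0 // ltr1n.
apply: limr_ge => //; near=> n.
have n0 : 0 < n%:R :> R by rewrite ltr0n; near: n; exists 1%N.
rewrite rE /= ler_expR ler_pdivrMr ?ltr0n // mulrAC ler_pdivlMr //.
rewrite [leLHS]mulr_natr [leRHS]mulr_natr -!lnXn //.
by rewrite ler_ln ?posrE ?exprn_gt0 // -!natrX ler_nat.
Unshelve. all: by end_near. Qed.

End Exponential.

(** * Finite symmetric generating sets of generated subgroups *)

Section GeneratedGroup.
Local Open Scope group_scope.
Local Open Scope classical_set_scope.
Variable gT : groupType.

Lemma mem_generated (A : set gT) a : A a -> a \in generated A.
Proof. by move=> Aa; apply/asboolP => H _; apply. Qed.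

Lemma generatedV (A : set gT) a : a \in generated A -> a^-1 \in generated A.
Proof. exact: group_closedV (generated_closed A) _. Qed.

Lemma symmetric_generating_set_exists (A : set gT) : finite_set A ->
  exists S : {fset generated_group A}, symmetric_generating_set S.
Proof.
move=> finA; pose val_g : generated_group A -> gT := @generated_elt gT A.
have val1 : val_g 1 = 1 by [].
have valM g h : val_g (g * h) = val_g g * val_g h by [].
have valV g : val_g g^-1 = (val_g g)^-1.
  by apply: (mulgI (val_g g)); rewrite -valM !mulgV.
have finB : finite_set (val_g @^-1` (A `|` [set a^-1 | a in A])).
  apply: finite_preimage; first by move=> g h _ _; apply: val_inj.
  by rewrite finite_setU; split=> //; apply: finite_image.
have memS g : g \in fset_set (val_g @^-1` (A `|` [set a^-1 | a in A])) <->
    A (val_g g) \/ exists2 a, A a & a^-1 = val_g g.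
  by rewrite in_fset_set // inE.
exists (fset_set (val_g @^-1` (A `|` [set a^-1 | a in A]))); split.
  move=> g /memS[Ag|[a Aa ga]]; apply/memS; rewrite valV.
    by right; exists (val_g g).
  by left; rewrite -ga invgK.
move=> g; apply/asboolP => H Hcl SH.
have /asboolP gen := generated_eltP g.
(* [H] lives in the subgroup type, whereas membership in [generated A] tests predicates on [gT];
   hence the image of [H] under the inclusion. *)
suff /asboolP[h hH /val_inj <-] :
    val_g g \in [pred a | `[< exists2 h, h \in H & val_g h = a >]] by [].
apply: gen => [|a Aa].
  split; first by apply/asboolP; exists 1 => //; apply: Hcl.1.
  move=> _ _ /asboolP[h hH <-] /asboolP[k kH <-]; apply/asboolP.
  by exists (h * k^-1); [apply: Hcl.2 | rewrite valM valV].
apply/asboolP; exists (GeneratedGroup (mem_generated Aa)) => //.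
by apply/SH/memS; left.
Qed.

End GeneratedGroup.

(* [word_act] lets the head of the word act first, whereas in a product of
   bijections it acts last. *)
Lemma word_act_rev (V : finType) (x y z : V) u w :
  word_act x y z (rev u) w = foldr (letter_act x y z) w u.
Proof.
have word_act_rcons v c t : word_act x y z (rcons v c) t =
    letter_act x y z c (word_act x y z v t) by elim: v t => /=.
by elim: u => //= c u IHu; rewrite rev_cons word_act_rcons IHu.
Qed.

(** * From the graph to two generators *)

(** Otherwise every vertex has at most one neighbour, so the ends of an edge form a connected
    component, hence the whole graph, which leaves room for one edge only. *)
Lemma connected_cherry (V : finType) (E : rel V) :
  symmetric E -> irreflexive E -> (forall x y, connect E x y) ->
  (2 <= #|edges E|)%N -> exists x y z, [/\ x != z, E y x & E y z].
Proof.
move=> Esym Eirr Econn /card_gt1P[e [f [/imsetP[[a b] /= Eab ->]]]].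
case=> /imsetP[[c d] /= Ecd ->]; rewrite !inE /= in Eab Ecd * => abcd.
apply: contrapT => no_cherry.
have deg1 y x z : E y x -> E y z -> x = z.
  by move=> yx yz; apply/eqP/negPn/negP => xz; apply: no_cherry; exists x, y, z.
have ab_closed : fingraph.closed E [set a; b].
  apply: intro_closed; first exact: sym_connect_sym.
  move=> u v uv; rewrite !inE => /orP[]/eqP uE; move: uv; rewrite uE.
    by move=> /(deg1 _ _ _ Eab) ->; rewrite eqxx orbT.
  by rewrite Esym in Eab; move=> /(deg1 _ _ _ Eab) ->; rewrite eqxx.
have abT v : v \in [set a; b].
  by rewrite -(closed_connect ab_closed (Econn a v)) !inE eqxx.
move/eqP: abcd; apply; apply/setP => v; rewrite abT !inE; apply/esym.
move: (abT v) (abT c) (abT d) Ecd; rewrite !inE.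
by move=> /orP[]/eqP-> /orP[]/eqP-> /orP[]/eqP->; rewrite ?Eirr ?eqxx ?orbT.
Qed.

Lemma edge_act_sym (V : finType) (x y : V) : edge_act y x =1 edge_act_inv x y.
Proof. by elim=> //= z w ->. Qed.

(** [D] may hold the edge in the opposite direction, but reversing an edge inverts its action. Thus
    both edges at [y] can be taken outgoing, whatever the orientation. *)
Lemma edge_bijection_generated (V : finType) (E : rel V) (D : {set V * V}) x y :
  orientation E D -> E x y ->
  edge_bijection (x, y) \in
    generated [set edge_bijection e | e in [set` D]]%classic.
Proof.
move=> [_ Dor] /Dor; case: (boolP ((x, y) \in D)) => [xyD _|_ yxD].
  by apply: mem_generated; exists (x, y).
have -> : edge_bijection (x, y) = ((edge_bijection (y, x))^-1)%g.
  apply: (@mulgI _ (edge_bijection (y, x))); rewrite mulgV.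
  apply: eq_bijection => w; rewrite -[RHS](edge_actK x y) /=.
  exact: edge_act_sym.
by apply: generatedV; apply: mem_generated; exists (y, x).
Qed.

Theorem corollary3p1 (R : realType) (V : finType) (E : rel V)
  (Esym : symmetric E) (Eirr : irreflexive E)
  (Econn : forall x y : V, connect E x y)
  (Esize : (2 <= #|edges E|)%N)
  (D : {set V * V}) (Dor : orientation E D) :
  exponential_growth (graph_automaton_group D) R.
Proof.
split; first exact/symmetric_generating_set_exists/finite_image/finite_finset.
have [x [y [z [xz Eyx Eyz]]]] := connected_cherry Esym Eirr Econn Esize.
have yN t : E y t -> y != t by case: eqVneq => // <-; rewrite Eirr.
have xy : x != y by rewrite eq_sym yN.
have Et c : E y (if c then x else z) by case: c.
pose f c : graph_automaton_group D :=
  GeneratedGroup (edge_bijection_generated Dor (Et c)).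
have prodE u w : generated_elt (\prod_(c <- u) f c)%g w =
    foldr (letter_act x y z) w u.
  by elim: u => [|c u IHu]; rewrite ?big_nil // big_cons /= -IHu.
have finj : injective (fun u : seq bool => \prod_(c <- u) f c)%g.
  move=> u v /= uv; apply: (can_inj revK).
  apply: (word_act_inj xy (yN z Eyz) xz) => w.
  by rewrite !word_act_rev -!prodE uv.
move=> S Sgen; have [k k0 ak] := growth_free_monoid Sgen finj.
exact: exponential_growth_root k0 (growth_gt0 S) (growthD S) ak.
Qed.
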